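(* Let $r\in(0,\infty)$ and let $P$ be a Borel probability on $\mathbb{R}^d$ that is absolutely continuous with respect to Lebesgue measure $\lambda^d$ and satisfies $\int \|x\|^{r+\delta}\,dP(x)<\infty$ for some $\delta>0$. Then $$e_{n,r}^r-e_{n+1,r}^r\approx n^{-(1+r/d)},$$ i.e. the sequence $\big(n^{1+r/d}(e_{n,r}^r-e_{n+1,r}^r)\big)_{n\in\mathbb{N}}$ is bounded and bounded away from $0$.
   Context: $\|\cdot\|$ is an arbitrary fixed norm on $\mathbb{R}^d$, $d\ge 1$, $\mathbb{N}=\{1,2,\dots\}$, and $d(x,\alpha)=\min_{a\in\alpha}\|x-a\|$ for finite nonempty $\alpha\subset\mathbb{R}^d$. The $n$th-level $L^r(P)$-quantization error $e_{n,r}=e_{n,r}(P)$ is defined by $e_{n,r}^r=\inf\{\int d(x,\alpha)^r\,dP(x) : \alpha\subset\mathbb{R}^d,\ 1\le\operatorname{card}(\alpha)\le n\}$. For sequences, $a_n\approx b_n$ means that $(a_n/b_n)$ is bounded and bounded away from $0$. *)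

(* Defs.v *)
From HB Require Import structures.
From mathcomp Require Import all_boot all_order all_algebra.
From mathcomp Require Import finmap.
From mathcomp Require Import all_classical all_reals all_analysis.
From mathcomp Require Import measurable_realfun.

Set Implicit Arguments.
Unset Strict Implicit.
Unset Printing Implicit Defensive.

Import Order.TTheory GRing.Theory Num.Theory.
Import numFieldNormedType.Exports.

Local Open Scope classical_set_scope.
Local Open Scope ring_scope.

Notation borelRn R d := (g_sigma_algebraType (@open 'rV[R]_d)).

Section lebesgue_rV.
Variable R : realType.

Definition rV_cons d (xv : measurableTypeR R * borelRn R d) : borelRn R d.+1 :=
  row_mx (xv.1%:M : 'rV[R]_1) (xv.2 : 'rV[R]_d).

Definition rV_uncons d (w : borelRn R d.+1) : measurableTypeR R * borelRn R d :=
  ((w : 'rV[R]_(1 + d)) ord0 ord0, rsubmx (w : 'rV[R]_(1 + d))).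

Lemma rV_consK d : cancel (@rV_cons d) (@rV_uncons d).
Proof.
case=> x v; rewrite /rV_cons /rV_uncons row_mxKr /=; congr (_, _).
rewrite (_ : ord0 = lshift d (ord0 : 'I_1)); last exact: val_inj.
by rewrite row_mxEl mxE eqxx mulr1n.
Qed.

Lemma rV_unconsK d : cancel (@rV_uncons d) (@rV_cons d).
Proof.
move=> w; rewrite -[RHS](@hsubmxK _ 1 1 d w) /rV_cons /=.
suff -> : (w ord0 ord0)%:M = lsubmx (w : 'rV[R]_(1 + d)) by [].
apply/rowP => i; rewrite !mxE !ord1 eqxx mulr1n.
by congr (fun_of_matrix w _ _); apply: val_inj.
Qed.

Lemma measurable_rV_uncons d : measurable_fun setT (@rV_uncons d).
Proof.
apply: measurable_fun_pair.
  apply: (measurability _ (RGenOInfty.measurableE R)).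
  move=> _ [_ [x ->] <-]; rewrite setTI; apply: sub_sigma_algebra.
  apply: (@open_comp _ _ (fun w : 'rV[R]_d.+1 => w ord0 ord0)).
    by move=> w _; exact: coord_continuous.
  by rewrite set_itvE; exact: open_gt.
apply: (@measurability _ _ _ (borelRn R d) setT _ (@open 'rV[R]_d)) => //.
move=> _ [U oU <-]; rewrite setTI; apply: sub_sigma_algebra.
apply: (@open_comp _ _ (fun w : 'rV[R]_(1 + d) => rsubmx w)) oU => /= w _.
move=> A /= /nbhs_ballP[e /= e0 eA]; apply/nbhs_ballP; exists e => //= t [_ wt].
by apply: eA; split => // i j; rewrite !mxE; exact: wt.
Qed.

Lemma measurable_rV_cons d : measurable_fun setT (@rV_cons d).
Proof.
apply: (@measurability _ _ _ (borelRn R d.+1) setT _ (@open 'rV[R]_d.+1)) => //.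
move=> _ [U oU <-]; rewrite setTI.
pose B (i : rat * 'rV[rat]_d * rat) : set (measurableTypeR R * borelRn R d) :=
  (ball (ratr i.1.1 : R) (ratr i.2) : set R) `*`
  (ball (map_mx ratr i.1.2 : 'rV[R]_d) (ratr i.2) : set 'rV[R]_d).
have mB i : measurable (B i).
  apply: measurableX; first exact: measurable_ball.
  apply: sub_sigma_algebra.
  have [e0|e0] := ltP 0 (ratr i.2 : R); first exact: ball_open.
  rewrite (_ : ball _ _ = set0); first exact: open0.
  by rewrite -subset0 => v [/lt_le_trans/(_ e0)]; rewrite ltxx.
rewrite (_ : _ @^-1` U =
    \bigcup_(i in [set i | B i `<=` @rV_cons d @^-1` U]) B i).
  rewrite bigcup_mkcond; apply: countable_bigcupT_measurable => // i.
  by case: ifPn.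
apply/seteqP; split=> [[x v]|xv [i Bi /Bi]//].
rewrite /= /rV_cons /= => Uxv.
have /nbhs_ballP[e /= e0 eU] := open_nbhs_nbhs (conj oU Uxv).
have [q /andP[q0 qe]] : exists q : rat, 0 < (ratr q : R) < e / 2.
  have e20 : 0 < e / 2 by rewrite divr_gt0.
  by have [q] := rat_in_itvoo e20; rewrite in_itv /= => ?; exists q.
have apx (y : R) : exists p : rat, `|ratr p - y| < ratr q.
  have yq : y - ratr q < y + ratr q by rewrite ltrD2l gtrN.
  have [p] := rat_in_itvoo yq.
  rewrite in_itv /= => /andP[yp py]; exists p.
  by rewrite ltr_distl yp.
have [a ax] := apx x.
pose b := \row_j sval (cid (apx ((v : 'rV[R]_d) ord0 j))) : 'rV[rat]_d.
have bv j : `|ratr (b ord0 j) - (v : 'rV[R]_d) ord0 j| < ratr q.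
  by rewrite mxE; case: cid.
exists (a, b, q); last first.
  by split => //=; split => // i j; rewrite ord1 mxE; exact: bv.
move=> [y w] [/= ay [_ bw]]; apply: eU; split => // i j.
have tri (z t c : R) : `|c - z| < ratr q -> `|c - t| < ratr q -> `|z - t| < e.
  move=> cz ct; rewrite (splitr e) (le_lt_trans (ler_distD c _ _))//.
  by rewrite ltrD// ?(lt_trans _ qe)// distrC.
rewrite /ball /= !mxE; case: splitP => k _.
  by rewrite !mxE (ord1 i) (ord1 k) eqxx !mulr1n; exact: tri ax ay.
by rewrite (ord1 i); apply: tri (bv k) _; have := bw ord0 k; rewrite mxE.
Qed.

Section lebesgue_cons.
Variables (d : nat) (mu : {sigma_finite_measure set (borelRn R d) -> \bar R}).

Definition lebesgue_cons : set (borelRn R d.+1) -> \bar R :=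
  pushforward (@lebesgue_measure R \x mu)%E (@rV_cons d).

Let pm := measure_function_pushforward__canonical__measure_function_Measure
  (@lebesgue_measure R \x mu)%E (@measurable_rV_cons d).

HB.instance Definition _ := isMeasure.Build _ _ _ lebesgue_cons
  (measure0 pm) (measure_ge0 pm) (@measure_semi_sigma_additive _ _ _ pm).

Let lebesgue_cons_sigma_finite : sigma_finite setT lebesgue_cons.
Proof.
have /sigma_finiteP[F [TF ndF Foo]] := sigma_finiteT (@lebesgue_measure R).
have /sigma_finiteP[G [TG ndG Goo]] := sigma_finiteT mu.
exists (fun n => @rV_uncons d @^-1` (F n `*` G n)) => [|n].
  rewrite -preimage_bigcup -[LHS](@preimage_setT _ _ (@rV_uncons d)).
  congr (_ @^-1` _); apply/seteqP; split=> // -[x y] _.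
  have [n _ Fnx] : (\bigcup_n F n) x by rewrite -TF.
  have [k _ Gky] : (\bigcup_n G n) y by rewrite -TG.
  exists (maxn n k) => //; split.
  - by move: x Fnx; exact/subsetPset/ndF/leq_maxl.
  - by move: y Gky; exact/subsetPset/ndG/leq_maxr.
have [mF Fy] := Foo n; have [mG Gy] := Goo n.
have mFG : measurable (F n `*` G n) by exact: measurableX.
split; first by rewrite -[X in measurable X]setTI; exact: measurable_rV_uncons.
rewrite /lebesgue_cons /pushforward -comp_preimage.
rewrite (_ : _ \o _ = id); last by apply/funext => x; exact: rV_consK.
by rewrite preimage_id product_measure1E// lte_mul_pinfty// ge0_fin_numE.
Qed.

HB.instance Definition _ := Measure_isSigmaFinite.Build _ _ _ lebesgue_cons
  lebesgue_cons_sigma_finite.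
End lebesgue_cons.

(* d-dimensional Lebesgue measure as the d-fold product of the one on R,
   transported to row vectors along [rV_cons]. *)
Fixpoint lebesgue_rV d : {sigma_finite_measure set (borelRn R d) -> \bar R} :=
  if d is d'.+1 then lebesgue_cons (lebesgue_rV d')
  else @dirac _ (borelRn R 0) (0 : 'rV[R]_0) R.

Lemma measurable_box d (A : 'I_d -> set (measurableTypeR R)) :
  (forall i, measurable (A i)) ->
  measurable ([set v : 'rV[R]_d | forall i, A i (v ord0 i)] :
    set (borelRn R d)).
Proof.
elim: d A => [|d IH] A mA.
  rewrite (_ : [set _ | _] = setT)//.
  by apply/seteqP; split => // v _ [].
rewrite (_ : [set _ | _] = setT `&` @rV_uncons d @^-1`
  (A ord0 `*` [set v : 'rV[R]_d | forall i, A (lift ord0 i) (v ord0 i)])).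
  apply: measurable_rV_uncons => //; apply: measurableX; first exact: mA.
  by apply: (IH (fun i => A (lift ord0 i))) => i; exact: mA.
have E (v : 'rV[R]_d.+1) i :
    (rsubmx (v : 'rV[R]_(1 + d))) ord0 i = v ord0 (lift ord0 i).
  by rewrite mxE; congr (fun_of_matrix v _ _); exact: val_inj.
apply/seteqP; split => [v /= Av|v [_ [/= A0 Av]] i].
  by split => //; split => // i; rewrite /rV_uncons /= E; exact: Av.
have [j ->|->//] := unliftP ord0 i.
by have := Av j; rewrite /rV_uncons /= E.
Qed.

Lemma lebesgue_rV_box d (A : 'I_d -> set (measurableTypeR R)) :
  (forall i, measurable (A i)) ->
  lebesgue_rV d [set v : 'rV[R]_d | forall i, A i (v ord0 i)] =
  (\prod_(i < d) @lebesgue_measure R (A i))%E.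
Proof.
elim: d A => [|d IH] A mA.
  by rewrite big_ord0 /= diracE mem_set// => -[].
rewrite big_ord_recl -IH//= /lebesgue_cons /pushforward.
rewrite -product_measure1E//; last first.
  by apply: (@measurable_box d (fun i => A (lift ord0 i))) => i; exact: mA.
congr (_ _); apply/seteqP; split => [[x v]|[x v] [/= A0 Av] i]; last first.
  rewrite /rV_cons mxE; case: splitP => j ji.
    have -> : i = ord0 by apply/val_inj; rewrite /= ji ord1.
    by rewrite mxE (ord1 j) eqxx mulr1n.
  by rewrite (_ : i = lift ord0 j)//; apply/val_inj.
move=> /= Av; split => [|i] /=.
  have := Av ord0; rewrite /rV_cons mxE; case: splitP => j //= _.
  by rewrite mxE !ord1 eqxx mulr1n.
have := Av (lift ord0 i); rewrite /rV_cons mxE; case: splitP => j /= ji.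
  by have := ltn_ord j; rewrite -ji.
by rewrite (_ : j = i)//; apply/val_inj; move: ji => /= [].
Qed.
End lebesgue_rV.

Section quantization.
Variables (R : realType) (d : nat).
Implicit Type N : 'rV[R]_d -> R.

Definition is_norm N :=
  [/\ forall x y, N (x + y) <= N x + N y,
      forall (c : R) x, N (c *: x) = `|c| * N x &
      forall x, N x = 0 -> x = 0].

Local Open Scope ereal_scope.

(* +oo is only the value for the empty alpha, excluded below. *)
Definition min_dist N (x : 'rV[R]_d) (alpha : {fset 'rV[R]_d}) : \bar R :=
  \big[Order.min/+oo]_(a <- alpha) (N (x - a)%R)%:E.

Definition quantization_error N (P : probability (borelRn R d) R) (r : R)
    (n : nat) : \bar R :=
  ereal_inf [set \int[P]_x (min_dist N x alpha `^ r) |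
    alpha in [set alpha : {fset 'rV[R]_d} | (1 <= #|` alpha| <= n)%N]] `^ r^-1.

End quantization.

(* a_n ~~ b_n over n >= 1: the ratio is bounded and bounded away from 0. *)
Definition same_order (R : realType) (a : nat -> \bar R) (b : nat -> R) :=
  exists c C : R, 0 < c /\ forall n, (1 <= n)%N ->
    (c%:E <= `|a n * (b n)^-1%:E| <= C%:E)%E.

(* Main.v *)
Require Import Defs.
From HB Require Import structures.
From mathcomp Require Import all_boot all_order all_algebra.
From mathcomp Require Import finmap.
From mathcomp Require Import all_classical all_reals all_analysis.
From mathcomp Require Import measurable_realfun ring lra.

Set Implicit Arguments.
Unset Strict Implicit.
Unset Printing Implicit Defensive.

Import Order.TTheory GRing.Theory Num.Theory.
Import numFieldNormedType.Exports.

Local Open Scope classical_set_scope.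
Local Open Scope ring_scope.

(** Write [s = n ^ (1 / d)] and [E n] for the infimum of the [r]-th power mean error
    over codebooks of at most [n] points, so that the claim is that [E n - E n.+1]
    has the order of [1 / (n * s ^ r)].  Both bounds are proved for an arbitrary
    codebook [a] in place of an optimal one, and then passed to the infimum; the
    existence of optimal codebooks is not needed.

    Two facts are used throughout.  First, for each [u >= 1] there is a net of at most
    [(2 u) ^ d] points in which every [x] has a neighbour at distance at most a
    constant times [(1 + |x|) ^ (1 + 1 / p) / u] ([net_rV]): a product of
    one-dimensional nets, themselves images of uniform grids.  Second, since [P] is
    absolutely continuous, at least half of its mass lies in a fixed ball and outside
    the [t]-neighbourhood of any given [m] points as soon as [m * t ^ d] is small
    ([bulk]), because this neighbourhood then has small Lebesgue measure.

    Lower bound ([qinf_gap_ge]).  Given a set [a] of [n] points, consider the mass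
    in a fixed ball at distance at least [tau / s] from [a], for a small constant
    [tau], and cover this part of space by balls of radius [tau / (2 s)] around a net of
    at most [L n] points.  One of these balls carries mass at least [1 / (2 L n)] of
    it; adding its centre to [a] decreases the error by a constant times
    [s ^ (- r)] times this mass.

    Upper bound ([qinf_gap_le]).  With [u] equal to [s / 2] the net shows that [E n] is
    at most a constant times [s ^ (- r)], thanks to the moment of order [r + delta]
    ([qinf_le_rate]).  Now let [a] have [n + 1] points and an error of this order.  By
    [bulk] it has at least [k n] points in a fixed ball ([card_bulk]), and by
    comparison with a net of at most [k n / 2] points, at least [k n / 2] of these
    have another point of [a] at distance at most [h], a constant times [1 / s]
    ([card_close]).  Removing such a point only affects the [x] of which it is the
    nearest point, and increases their distance to the codebook by at most [h].  Hence
    the increases of the error add up to at most a constant times [s ^ (- r)], and one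
    of the points can be removed at a cost of order [1 / (n * s ^ r)]
    ([qcost_remove]). *)

(** * Equivalence of a norm with the maximum norm *)

Section norm_equivalence.
Context (R : realType) (d : nat).
Variable N : 'rV[R]_d -> R.
Hypothesis normN : is_norm N.

Let ND := let: And3 h _ _ := normN in h.
Let NZ := let: And3 _ h _ := normN in h.
Let N_eq0 := let: And3 _ _ h := normN in h.

Lemma is_norm0 : N 0 = 0.
Proof. by rewrite -(scale0r 0) NZ normr0 mul0r. Qed.

Lemma is_normN x : N (- x) = N x.
Proof. by rewrite -scaleN1r NZ normrN1 mul1r. Qed.

Lemma is_norm_ge0 x : 0 <= N x.
Proof.
have := ND x (- x); rewrite subrr is_norm0 is_normN -mulr2n.
by rewrite pmulrn_lge0.
Qed.

Lemma is_norm_dist x y : `|N x - N y| <= N (x - y).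
Proof.
have := ND (x - y) y; rewrite subrK => xy.
have := ND (y - x) x; rewrite subrK -(is_normN (y - x)) opprB => yx.
by rewrite ler_norml; apply/andP; split; lra.
Qed.

Lemma coord_le_mx_norm (x : 'rV[R]_d) j : `|x ord0 j| <= `|x|.
Proof.
by rewrite [leRHS]/Num.Def.normr/= mx_normrE; apply/bigmax_geP; right => /=; exists (ord0, j).
Qed.

Lemma mx_norm_le (x : 'rV[R]_d) e :
  0 <= e -> (forall j, `|x ord0 j| <= e) -> `|x| <= e.
Proof.
move=> e0 xe; rewrite [leLHS]/Num.Def.normr/= mx_normrE (bigmax_le _ e0)//= => -[i j] _ /=.
by rewrite ord1.
Qed.

Lemma is_norm_le_mx_norm : exists2 C : R, 0 < C & forall x, N x <= C * `|x|.
Proof.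
exists (1 + \sum_(j < d) N (delta_mx ord0 j)).
  by rewrite ltr_pwDl// sumr_ge0// => j _; exact: is_norm_ge0.
move=> x; rewrite [X in N X]row_sum_delta.
have le_sum (r : seq 'I_d) (F : 'I_d -> 'rV[R]_d) :
    N (\sum_(j <- r) F j) <= \sum_(j <- r) N (F j).
  elim/big_ind2 : _ => [|a b c e ab ce|//]; first by rewrite is_norm0.
  by rewrite (le_trans (ND _ _))// lerD.
rewrite (le_trans (le_sum _ _))// mulrDl mul1r mulr_suml.
apply: ler_wpDl => //; apply: ler_sum => j _.
by rewrite NZ mulrC ler_wpM2l ?is_norm_ge0// coord_le_mx_norm.
Qed.

Lemma continuous_is_norm_sub (z : 'rV[R]_d) :
  continuous (fun x : 'rV[R]_d => N (x - z)).
Proof.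
have [C C0 NC] := is_norm_le_mx_norm.
move=> x; apply/(@cvgrPdist_le _ _ _ (nbhs x) (nbhs_filter x)) => e e0.
rewrite near_simpl; apply/nbhs_ballP.
exists (C^-1 * e); first by rewrite /= mulr_gt0 ?invr_gt0.
move=> y; rewrite mx_norm_ball => /= /ltW yx.
rewrite (le_trans (is_norm_dist _ _))// opprB addrA subrK.
by rewrite (le_trans (NC _))// -ler_pdivlMl.
Qed.

Lemma continuous_is_norm : continuous N.
Proof.
rewrite [X in continuous X](_ : _ = fun x : 'rV[R]_d => N (x - 0)).
  exact: continuous_is_norm_sub.
by apply/funext => x; rewrite subr0.
Qed.

(** The constant is the minimum of [N] on the unit sphere, which is compact. *)
Lemma mx_norm_le_is_norm : (0 < d)%N ->
  exists2 c : R, 0 < c & forall x, c * `|x| <= N x.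
Proof.
move=> d0; pose S := [set x : 'rV[R]_d | `|x| = 1].
have cS : compact S.
  apply: bounded_closed_compact.
    exists 1; split => // M M1 x Sx.
    by suff : `|x : 'rV[R]_d| <= M by []; rewrite Sx ltW.
  apply: (@closed_comp _ _ (fun x : 'rV[R]_d => `|x|) [set 1]).
    by move=> x _; exact: norm_continuous.
  exact: closed_eq.
have nzv0 : `|const_mx 1 : 'rV[R]_d| = 1.
  apply/eqP; rewrite eq_le mx_norm_le//=; last by move=> j; rewrite mxE normr1.
  by have := coord_le_mx_norm (const_mx 1) (Ordinal d0); rewrite mxE normr1.
have [||x0] := EVT_min_rV _ cS (f := N); first by exists (const_mx 1).
  by apply: continuous_subspaceT; exact: continuous_is_norm.
rewrite inE => x01 x0min; exists (N x0).
  rewrite lt_neqAle is_norm_ge0 andbT eq_sym; apply/eqP => /N_eq0 x00.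
  by move/eqP: x01; rewrite x00 normr0 eq_sym oner_eq0.
move=> x; have [->|x_neq0] := eqVneq x 0.
  by rewrite normr0 mulr0 is_norm0.
have nx0 : 0 < `|x| by rewrite normr_gt0.
have := x0min (`|x|^-1 *: x); rewrite inE /S /= normrZ NZ normfV normr_id.
by rewrite mulVf ?gt_eqF// => /(_ erefl); rewrite -ler_pdivrMl ?invr_gt0// invrK mulrC.
Qed.

End norm_equivalence.

(** * Nets whose mesh grows with the distance to the origin *)

Section nets.
Context {R : realType}.

(** On the positive reals, the convex function [z |-> z `^ (- p)] lies above its
    tangent at [u]. *)
Lemma powRN_tangent (p u v : R) : 0 < p -> 0 < u -> u <= v ->
  u `^ (- p) - v `^ (- p) <= p * u `^ (- p - 1) * (v - u).
Proof.
move=> p0 u0 uv; have v0 : 0 < v by exact: lt_le_trans uv.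
have vu0 : 0 < v / u by rewrite divr_gt0.
have Ep : v `^ (- p) = u `^ (- p) * (v / u) `^ (- p).
  by rewrite -powRM ?(ltW u0) ?(ltW vu0)// mulrC divfK// gt_eqF.
have Eu : u `^ (- p - 1) = u `^ (- p) / u.
  by rewrite powRB ?powRr1 ?(ltW u0)// (gt_eqF u0) implybT.
have -> : p * u `^ (- p - 1) * (v - u) = u `^ (- p) * (p * (v / u - 1)).
  by rewrite Eu; field; rewrite gt_eqF.
rewrite Ep -[X in X - _]mulr1 -mulrBr ler_wpM2l ?powR_ge0//.
rewrite lerBlDr -lerBlDl /powR gt_eqF//.
apply: le_trans (expR_ge1Dx _); rewrite lerD2l mulNr lerN2 ler_wpM2l ?(ltW p0)//.
by have := @le_ln1Dx R (v / u - 1); rewrite (addrC 1) subrK ltrBrDr addNr; apply.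
Qed.

(** The nodes are the images of the uniform grid [k / m] of the interval from 0 to 1
    under [s |-> s `^ (- p) - 1], and their opposites; the derivative of this change
    of variable is of order [(1 + t) `^ (1 + 1 / p)] at the point sent to [t]. *)
Lemma net_real (p : R) (m : nat) : 0 < p -> (0 < m)%N ->
  exists2 b : seq R, size b = m.*2 &
    forall t, exists2 y, y \in b &
      `|t - y| <= p / m%:R * (1 + `|t|) `^ (1 + p^-1).
Proof.
move=> p0 m0.
have m0R : 0 < m%:R :> R by rewrite ltr0n.
pose g k : R := (k.+1%:R / m%:R) `^ (- p) - 1.
exists ([seq g k | k <- iota 0 m] ++ [seq - g k | k <- iota 0 m]).
  by rewrite size_cat !size_map size_iota addnn.
have pos t : 0 <= t -> exists2 k, (k < m)%N &
    `|t - g k| <= p / m%:R * (1 + t) `^ (1 + p^-1).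
  move=> t0; have t1 : 0 < 1 + t by rewrite ltr_wpDr.
  pose s := (1 + t) `^ (- p^-1).
  have s0 : 0 < s by rewrite powR_gt0.
  have s1 : s <= 1.
    rewrite /s -[leRHS](powRr0 (1 + t)) ler_powR ?lerDl// oppr_le0 invr_ge0.
    exact: ltW.
  (* k + 1 is the ceiling of s m *)
  have [k /andP[ks sk]] : exists k, (k%:R < s * m%:R <= k.+1%:R).
    have : exists k, s * m%:R <= k%:R.
      by exists (Num.truncn (s * m%:R)).+1; exact/ltW/truncnS_gt.
    case/ex_minnP => -[|k] sk kmin.
      by move: sk; rewrite leNgt mulr_gt0.
    by exists k; rewrite sk andbT ltNge; apply/negP => /kmin; rewrite ltnn.
  exists k.
    by rewrite -(ltr_nat R) (lt_le_trans ks)// ler_piMl.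
  have sp : s `^ (- p) = 1 + t.
    by rewrite -powRrM mulrNN mulVf ?gt_eqF// powRr1// ltW.
  have sk1 : s <= k.+1%:R / m%:R by rewrite ler_pdivlMr.
  have -> : t - g k = s `^ (- p) - (k.+1%:R / m%:R) `^ (- p).
    by rewrite sp /g opprB addrA (addrC t).
  rewrite ger0_norm ?subr_ge0; last first.
    have sk0 := lt_le_trans s0 sk1.
    rewrite !powRN lef_pV2 ?posrE ?powR_gt0//.
    by rewrite ge0_ler_powR ?nnegrE ?(ltW p0) ?(ltW s0) ?(ltW sk0).
  rewrite (le_trans (powRN_tangent p0 s0 sk1))//.
  have -> : s `^ (- p - 1) = (1 + t) `^ (1 + p^-1).
    by rewrite -powRrM; congr (_ `^ _); field; rewrite gt_eqF.
  rewrite mulrAC ler_wpM2r ?powR_ge0// ler_wpM2l ?(ltW p0)//.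
  rewrite lerBlDr ler_pdivrMr// mulrDl mulVf ?gt_eqF// -natr1 addrC lerD2l.
  exact: ltW.
move=> t; have [t0|t0] := leP 0 t.
  have [k km kt] := pos _ t0; exists (g k).
    by rewrite mem_cat; apply/orP; left; apply: map_f; rewrite mem_iota.
  by rewrite (ger0_norm t0).
have [|k km kt] := pos (- t); first by rewrite oppr_ge0 ltW.
exists (- g k).
  rewrite mem_cat; apply/orP; right.
  by apply: (map_f (fun k => - g k)); rewrite mem_iota.
rewrite (_ : t - - g k = - (- t - g k)); last by ring.
by rewrite normrN (ltr0_norm t0).
Qed.

(** A product of [d] copies of the net of [net_real], with [m] the integer part of [u]. *)
Lemma net_rV (d : nat) (p u : R) : 0 < p -> 1 <= u ->
  exists2 Y : {fset 'rV[R]_d}, (#|` Y|%:R <= (2 * u) ^+ d) &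
    forall x, exists2 y, y \in Y &
      `|x - y| <= 2 * p / u * (1 + `|x|) `^ (1 + p^-1).
Proof.
move=> p0 u1; set m := Num.truncn u.
have u0 : 0 < u by rewrite (lt_le_trans ltr01).
have /andP[mu um] : m%:R <= u < m.+1%:R by rewrite truncn_itv// ltW.
have m0 : (0 < m)%N by rewrite truncn_gt0.
have [b sb bP] := net_real p0 m0.
exists [fset x in [seq \row_j b`_(f j) | f : {ffun 'I_d -> 'I_(m.*2)}]]%fset.
  rewrite (@le_trans _ _ (m.*2 ^ d)%:R)// ?ler_nat.
    rewrite card_fseq (leq_trans (size_undup _))// size_map.
    by rewrite -cardE card_ffun !card_ord.
  rewrite natrX lerXn2r ?nnegrE ?ler0n ?mulr_ge0 ?(ltW u0)//.
  by rewrite -mul2n natrM ler_wpM2l.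
move=> x.
have /choice[f fP] : forall j, exists k : 'I_(m.*2),
    `|x ord0 j - b`_k| <= p / m%:R * (1 + `|x ord0 j|) `^ (1 + p^-1).
  move=> j.
  have [y /(nthP 0)[i isz <-] yP] := bP (x ord0 j).
  by rewrite sb in isz; exists (Ordinal isz).
exists (\row_j b`_(f j)).
  rewrite inE /=; apply/mapP; exists [ffun j => f j]; first by rewrite mem_enum.
  by apply/rowP => j; rewrite !mxE ffunE.
apply: mx_norm_le => [|j].
  by rewrite mulr_ge0 ?powR_ge0// divr_ge0 ?mulr_ge0 ?(ltW p0) ?(ltW u0).
rewrite !mxE (le_trans (fP j))// ler_pM ?powR_ge0 ?divr_ge0 ?(ltW p0)//.
- rewrite ler_pdivlMr// mulrAC ler_pdivrMr ?ltr0n// (mulrC 2) -mulrA.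
  rewrite ler_wpM2l ?(ltW p0)// (le_trans (ltW um))// -natrM ler_nat mul2n.
  by rewrite -addnn -addn1 leq_add2l.
- rewrite ge0_ler_powR ?nnegrE ?addr_ge0 ?invr_ge0 ?(ltW p0)//.
  by rewrite lerD2l coord_le_mx_norm.
Qed.

End nets.

(** * Lebesgue measure of small neighbourhoods *)

Section lebesgue_balls.
Context {R : realType} {d : nat}.

Lemma measurable_open_rV (U : set 'rV[R]_d) :
  open U -> measurable (U : set (borelRn R d)).
Proof. by move=> oU; exact: sub_sigma_algebra. Qed.

Lemma measurable_continuous_rV (f : 'rV[R]_d -> R) :
  continuous f -> measurable_fun [set: borelRn R d] (f : borelRn R d -> R).
Proof.
move=> cf; apply: (measurability _ (RGenOInfty.measurableE R)).
move=> _ [_ [x ->] <-]; rewrite setTI; apply: measurable_open_rV.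
by apply: (@open_comp _ _ f) => [w _|]; [exact: cf|rewrite set_itvE; exact: open_gt].
Qed.

Lemma measurable_mx_norm :
  measurable_fun [set: borelRn R d] (fun x : borelRn R d => `|x : 'rV[R]_d|).
Proof. by apply: measurable_continuous_rV => x; exact: norm_continuous. Qed.

Lemma ball_rVE (a : 'rV[R]_d) (t : R) : 0 < t ->
  ball a t = [set v | forall j, ball (a ord0 j) t (v ord0 j)].
Proof.
move=> t0; apply/seteqP; split=> [v [_ av] j|v av]; first exact: av.
by split => // i j; rewrite !ord1; exact: av.
Qed.

Lemma lebesgue_rV_ball (a : 'rV[R]_d) (t : R) : 0 < t ->
  lebesgue_rV R d (ball a t) = ((2 * t) ^+ d)%:E.
Proof.
move=> t0; rewrite ball_rVE// (@lebesgue_rV_box _ _ (fun j => ball (a ord0 j) t)).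
  rewrite (eq_bigr (fun=> (2 * t)%:E)) => [|j _].
    by rewrite prodEFin prodr_const card_ord.
  by rewrite lebesgue_measure_ball ?ltW// mulr_natl.
by move=> j; exact: measurable_ball.
Qed.

Lemma measurable_bigballs (s : seq 'rV[R]_d) (t : R) : 0 < t ->
  measurable (\big[setU/set0]_(a <- s) ball a t : set (borelRn R d)).
Proof.
move=> t0; apply: bigsetU_measurable => a _; apply: measurable_open_rV.
exact: ball_open.
Qed.

Lemma lebesgue_rV_bigballs (s : seq 'rV[R]_d) (t : R) : 0 < t ->
  (lebesgue_rV R d (\big[setU/set0]_(a <- s) ball a t) <=
   ((size s)%:R * (2 * t) ^+ d)%:E)%E.
Proof.
move=> t0; elim: s => [|a s IH]; first by rewrite big_nil measure0 mul0r.
rewrite big_cons (le_trans (measureU2 _ _ _))//.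
- by apply: measurable_open_rV; exact: ball_open.
- exact: measurable_bigballs.
rewrite /= -natr1 mulrDl mul1r addrC EFinD leeD// ?IH//.
by rewrite [leLHS]lebesgue_rV_ball.
Qed.

End lebesgue_balls.

Section finite_measures.
Context d {T : measurableType d} {R : realType}.
Variable P : {finite_measure set T -> \bar R}.

(** The epsilon-delta form of absolute continuity. *)
Lemma dominates_eps_delta (mu : {measure set T -> \bar R}) : P `<< mu ->
  forall e : R, 0 < e -> exists2 eta : R, 0 < eta &
    forall A, measurable A -> (mu A < eta%:E)%E -> (P A < e%:E)%E.
Proof.
move=> Pmu e e0; pose nu := charge_of_finite_measure P.
have [X [Y nuXY]] := Hahn_decomposition nu.
have [eta [eta0 H]] := @charge_variation_continuous _ _ _ nu _ _ nuXY mu Pmu _ e0.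
exists eta => // A mA /(H _ mA); apply: le_lt_trans.
by rewrite (le_trans _ (abse_charge_variation nuXY mA))// lee_abs.
Qed.

End finite_measures.

(** * Distance to a finite set *)

Section min_distance.
Context {R : realType} {d : nat}.
Variable N : 'rV[R]_d -> R.
Hypothesis normN : is_norm N.
Implicit Types (a : {fset 'rV[R]_d}) (x y : 'rV[R]_d).

Lemma min_dist_le a x y : y \in a -> (min_dist N x a <= (N (x - y))%:E)%E.
Proof. by move=> ya; rewrite /min_dist; exact: ge_bigmin_seq. Qed.

Lemma min_dist_attained a x : a != fset0 ->
  exists2 y, y \in a & min_dist N x a = (N (x - y))%:E.
Proof.
rewrite -cardfs_gt0 /min_dist.
suff H (s : seq 'rV[R]_d) : (0 < size s)%N -> exists2 y, y \in s &
    (\big[Order.min/+oo]_(z <- s) (N (x - z))%:E = (N (x - y))%:E)%E by exact: H.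
elim: s => //= y s IH _.
have [->|s0] := eqVneq s [::].
  by exists y; rewrite ?mem_head// big_cons big_nil min_l ?leey.
have [|z zs sz] := IH; first by rewrite lt0n size_eq0.
rewrite big_cons sz; case: (leP (N (x - y))%:E (N (x - z))%:E) => _.
  by exists y; rewrite ?mem_head.
by exists z; rewrite // inE zs orbT.
Qed.

(** The distance to a nonempty finite set, as a real number; it is 0 for the
    empty set. *)
Definition rdist (a : {fset 'rV[R]_d}) (x : 'rV[R]_d) : R := fine (min_dist N x a).

Lemma rdist_attained a x : a != fset0 -> exists2 y, y \in a & rdist a x = N (x - y).
Proof. by move=> /(min_dist_attained x)[y ya ax]; exists y; rewrite /rdist ?ax. Qed.

Lemma min_distE a x : a != fset0 -> min_dist N x a = (rdist a x)%:E.
Proof. by move=> /(min_dist_attained x)[y ya]; rewrite /rdist => ->. Qed.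

Lemma rdist_le a x y : y \in a -> rdist a x <= N (x - y).
Proof.
move=> ya; rewrite -lee_fin -min_distE ?min_dist_le//.
by apply/fset0Pn; exists y.
Qed.

Lemma rdist_ge0 a x : 0 <= rdist a x.
Proof.
have [->|/(rdist_attained x)[y _ ->]] := eqVneq a fset0.
  by rewrite /rdist /min_dist big_nil.
exact: is_norm_ge0.
Qed.

Lemma measurable_min_dist a :
  measurable_fun [set: borelRn R d] (fun x : borelRn R d => min_dist N x a).
Proof.
rewrite /min_dist; elim: (enum_fset a : seq _) => [|y s IH].
  by under eq_fun do rewrite big_nil; exact: measurable_cst.
under eq_fun do rewrite big_cons.
apply: measurable_mine => //; apply/measurable_EFinP.
apply: (@measurable_continuous_rV _ _ (fun x => N (x - y))).
exact: continuous_is_norm_sub.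
Qed.

Lemma measurable_rdist a :
  measurable_fun [set: borelRn R d] (fun x : borelRn R d => rdist a x).
Proof.
by apply: (measurableT_comp (f := fine)) => //; exact: measurable_min_dist.
Qed.

Lemma measurable_norm_sub y :
  measurable_fun [set: borelRn R d] (fun x : borelRn R d => N (x - y)).
Proof.
have := measurable_rdist [fset y]%fset; apply: eq_measurable_fun => x _.
have [|z] := @rdist_attained [fset y]%fset x; first by rewrite -cardfs_gt0 cardfs1.
by rewrite inE => /eqP ->.
Qed.

Section small_neighbourhoods.
Variable P : probability (borelRn R d) R.
Hypothesis P_ac : P `<< lebesgue_rV R d.
Hypothesis d_gt0 : (0 < d)%N.

Lemma measurable_min_dist_lt a (t : R) :
  measurable ([set x | (min_dist N x a < t%:E)%E] : set (borelRn R d)).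
Proof.
rewrite -[X in measurable X]setTI; apply: emeasurable_fun_infty_o => //.
exact: measurable_min_dist.
Qed.

(** Few small balls carry little mass: the [t]-neighbourhood of [a] has Lebesgue
    measure at most a constant times [#|a| * t ^ d]. *)
Lemma prob_min_dist_lt (e : R) : 0 < e -> exists2 eta : R, 0 < eta &
  forall a t, 0 < t -> #|` a|%:R * t ^+ d <= eta ->
    (P [set x | (min_dist N x a < t%:E)%E] < e%:E)%E.
Proof.
move=> e0; have [c c0 cN] := mx_norm_le_is_norm normN d_gt0.
have [eta eta0 H] := dominates_eps_delta P_ac e0.
pose k := (2 / c) ^+ d; have k0 : 0 < k by rewrite exprn_gt0// divr_gt0.
exists (eta / (2 * k)); first by rewrite divr_gt0// mulr_gt0.
move=> a t t0 at_eta.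
have tc0 : 0 < t / c by rewrite divr_gt0.
apply: H; first exact: measurable_min_dist_lt.
apply: (@le_lt_trans _ _ (lebesgue_rV R d (\big[setU/set0]_(y <- a) ball y (t / c)))).
  apply: le_measure; rewrite ?inE.
  - exact: measurable_min_dist_lt.
  - exact: measurable_bigballs.
  move=> x /= xt; rewrite -bigcup_seq.
  have a0 : a != fset0.
    by apply/eqP => a0; move: xt; rewrite a0 /min_dist big_nil.
  have [y ya xy] := min_dist_attained x a0; exists y => //=.
  rewrite mx_norm_ball /ball_/=.
  suff yxt : c * `|y - x| < t by rewrite ltr_pdivlMr// mulrC.
  by rewrite (le_lt_trans (cN _))// -(is_normN normN) opprB -lte_fin -xy.
rewrite (le_lt_trans (lebesgue_rV_bigballs _ tc0))// lte_fin.
rewrite (_ : 2 * (t / c) = (2 / c) * t); last by rewrite mulrA mulrAC.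
rewrite exprMn -/k mulrCA -ltr_pdivlMl// (le_lt_trans at_eta)//.
rewrite mulrC ltr_pM2r// invfM -[ltRHS]mul1r ltr_pM2r ?invr_gt0//.
by rewrite invf_lt1// ltr1n.
Qed.

End small_neighbourhoods.
End min_distance.

(** * Averages over finite sequences *)

Section pigeonhole.
Context {R : realType}.

Lemma seq_arg_extremum (T : eqType) (e : rel T) (s : seq T) :
  total e -> transitive e -> s != [::] ->
  exists2 y, y \in s & forall z, z \in s -> e y z.
Proof.
move=> e_total e_trans; elim: s => //= y s IH _.
have e_refl z : e z z by have := e_total z z; rewrite orbb.
have [->|/IH[z zs zP]] := eqVneq s [::].
  by exists y => [|z]; rewrite inE// => /eqP ->.
have [yz|zy] := orP (e_total y z); [exists y|exists z].
- by rewrite mem_head.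
- move=> w; rewrite inE => /predU1P[->//|/zP]; exact: e_trans.
- by rewrite inE zs orbT.
- by move=> w; rewrite inE => /predU1P[->//|/zP].
Qed.

Local Open Scope ereal_scope.

Lemma sume_seq_const (T : Type) (s : seq T) (c : \bar R) : 0 <= c ->
  \sum_(y <- s) c = (size s)%:R%:E * c.
Proof.
move=> c0; elim: s => [|y s IH]; first by rewrite big_nil mul0e.
by rewrite big_cons IH /= -natr1 EFinD addeC ge0_muleDl ?lee_fin// mul1e.
Qed.

Lemma exists_le_average (T : eqType) (s : seq T) (f : T -> \bar R) :
  (forall y, 0 <= f y) -> s != [::] ->
  exists2 y, y \in s & (size s)%:R%:E * f y <= \sum_(z <- s) f z.
Proof.
move=> f0 s0; have [|||y ys yP] := @seq_arg_extremum _ (fun y z => f y <= f z) s.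
- by move=> y z; exact: le_total.
- by move=> y z w; exact: le_trans.
- exact: s0.
exists y => //; rewrite -sume_seq_const// big_seq [leRHS]big_seq.
exact: lee_sum.
Qed.

Lemma exists_ge_average (T : eqType) (s : seq T) (f : T -> \bar R) :
  (forall y, 0 <= f y) -> s != [::] ->
  exists2 y, y \in s & \sum_(z <- s) f z <= (size s)%:R%:E * f y.
Proof.
move=> f0 s0; have [|||y ys yP] := @seq_arg_extremum _ (fun y z => f z <= f y) s.
- by move=> y z; exact: le_total.
- by move=> y z w yx; move/le_trans; exact.
- exact: s0.
exists y => //; rewrite -sume_seq_const// big_seq [leRHS]big_seq.
exact: lee_sum.
Qed.

Lemma measure_bigsetU_seq d (T : measurableType d) (mu : {measure set T -> \bar R})
    (I : Type) (s : seq I) (F : I -> set T) : (forall i, measurable (F i)) ->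
  mu (\big[setU/set0]_(i <- s) F i) <= \sum_(i <- s) mu (F i).
Proof.
move=> mF; elim: s => [|i s IH]; first by rewrite !big_nil measure0.
rewrite !big_cons (le_trans (measureU2 _ _ _))//.
  by apply: bigsetU_measurable => j _; exact: mF.
exact: leeD.
Qed.

End pigeonhole.

(** * Mean errors of codebooks *)

Section quantization_cost.
Context {R : realType} {d : nat}.
Variable N : 'rV[R]_d -> R.
Hypothesis normN : is_norm N.
Variable P : probability (borelRn R d) R.
Variable r : R.
Hypothesis r_gt0 : 0 < r.
Implicit Types a : {fset 'rV[R]_d}.
Local Open Scope ereal_scope.

(** The [r]-th power mean error of the codebook [a]. *)
Definition qcost a : \bar R := \int[P]_x (min_dist N x a `^ r).

(** The [r]-th power of the optimal error among codebooks of at most [n] points. *)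
Definition qinf (n : nat) : \bar R :=
  ereal_inf [set qcost a | a in [set a | (1 <= #|` a| <= n)%N]].

Lemma qcost_ge0 a : 0 <= qcost a.
Proof. by apply: integral_ge0 => x _; exact: poweR_ge0. Qed.

Lemma qinf_ge0 n : 0 <= qinf n.
Proof. by apply: le_ereal_inf_tmp => _ [a _ <-]; exact: qcost_ge0. Qed.

Lemma quantization_errorX n : quantization_error N P r n `^ r = qinf n.
Proof.
rewrite -[LHS]/(qinf n `^ r^-1 `^ r) -poweRrM mulVf ?gt_eqF//.
by rewrite poweRe1// qinf_ge0.
Qed.

Lemma qinf_le a n : (1 <= #|` a| <= n)%N -> qinf n <= qcost a.
Proof. by move=> an; apply: ge_ereal_inf; exists (qcost a) => //; exists a. Qed.

Lemma le_qinf n m : (n <= m)%N -> qinf m <= qinf n.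
Proof.
move=> nm; apply: ereal_inf_le_tmp => _ [a /andP[a1 an] <-]; exists a => //=.
by rewrite a1 (leq_trans an).
Qed.

Lemma qcostE a : a != fset0 -> qcost a = \int[P]_x (rdist N a x `^ r)%:E.
Proof. by move=> a0; apply: eq_integral => x _; rewrite min_distE. Qed.

Lemma measurable_rdist_powR a :
  measurable_fun [set: borelRn R d] (fun x : borelRn R d => (rdist N a x `^ r)%:E).
Proof.
apply/measurable_EFinP; apply: (measurableT_comp (measurable_powR _)).
exact: measurable_rdist.
Qed.

Lemma measurable_norm_gt (M : R) :
  measurable ([set x | (M < `|x|)%R] : set (borelRn R d)).
Proof.
rewrite -[X in measurable X]setTI.
have mf : measurable_fun [set: borelRn R d]
    (EFin \o (fun x : borelRn R d => `|x : 'rV[R]_d|)%R).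
  by apply/measurable_EFinP; exact: measurable_mx_norm.
exact: (emeasurable_fun_o_infty measurableT mf M%:E).
Qed.

Lemma measurable_norm_min_dist (M t : R) a :
  measurable ([set x | (`|x| <= M)%R /\ t%:E <= min_dist N x a] : set (borelRn R d)).
Proof.
have -> : [set x | (`|x| <= M)%R /\ t%:E <= min_dist N x a] =
    ~` ([set x | (M < `|x|)%R] `|` [set x | min_dist N x a < t%:E]).
  apply/seteqP; split=> [x [/= xM xt] [|]|x /= /not_orP[/negP xM /negP xt]].
  - by rewrite ltNge xM.
  - by rewrite ltNge xt.
  - by rewrite leNgt xM leNgt xt.
apply/measurableC/measurableU; first exact: measurable_norm_gt.
exact: measurable_min_dist_lt.
Qed.

Lemma prob_norm_gt (e : R) : (0 < e)%R -> exists2 M : R, (0 < M)%R &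
  P [set x | (M < `|x|)%R] < e%:E.
Proof.
move=> e0; pose G n : set (borelRn R d) := [set x : 'rV[R]_d | (n.+1%:R < `|x|)%R].
have mG n : measurable (G n) by exact: measurable_norm_gt.
have G0 : \bigcap_n G n = set0.
  apply/seteqP; split=> // x /(_ (Num.truncn `|x : 'rV[R]_d|) I) /=.
  by rewrite /G /= ltNge ltW// truncnS_gt.
have niG : nonincreasing_seq G.
  move=> n m nm; apply/subsetPset => x; rewrite /G /=; apply: le_lt_trans.
  by rewrite ler_nat.
have PG : (P \o G) n @[n --> \oo] --> P (\bigcap_n G n).
  apply: nonincreasing_cvg_mu => //; last by rewrite G0.
  by rewrite -ge0_fin_numE// fin_num_measure.
have niPG : nonincreasing_seq (P \o G).
  by move=> n m /niG /subsetPset nm /=; rewrite le_measure ?inE.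
have infG : ereal_inf (range (P \o G)) = 0.
  rewrite -(measure0 P) -G0; apply: cvg_unique PG => //.
  exact: ereal_nonincreasing_cvgn.
have /ereal_inf_lt[_ [n _ <-] nPe] : ereal_inf (range (P \o G)) < e%:E.
  by rewrite infG lte_fin.
by exists n.+1%:R.
Qed.

Hypothesis P_ac : P `<< lebesgue_rV R d.
Hypothesis d_gt0 : (0 < d)%N.

(** At least half of the mass lies in a fixed ball and away from the small
    neighbourhoods of any few points. *)
Lemma bulk : exists M eta : R, [/\ (0 < M)%R, (0 < eta)%R &
  forall a t, (0 < t)%R -> (#|` a|%:R * t ^+ d <= eta)%R ->
    2^-1%:E <= P [set x | (`|x| <= M)%R /\ t%:E <= min_dist N x a]].
Proof.
have e0 : (0 < 4^-1 :> R)%R by [].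
have [M M0 PM] := prob_norm_gt e0.
have [eta eta0 Peta] := prob_min_dist_lt normN P_ac d_gt0 e0.
exists M, eta; split => // a t t0 /(Peta _ _ t0) Pa.
have mA := measurable_norm_min_dist M t a.
set A := (X in P X); set p := P A.
have : 1 <= p + (P [set x | (M < `|x|)%R] + P [set x | min_dist N x a < t%:E]).
  have mM := measurable_norm_gt M.
  have mt := measurable_min_dist_lt normN a t.
  rewrite -(probability_setT P) (le_trans _ (leeD2l _ (measureU2 _ _ _)))//.
  rewrite (le_trans _ (measureU2 _ _ _))//; last exact: measurableU.
  apply: le_measure; rewrite ?inE//; first by do ?apply: measurableU.
  move=> x _; have [xM|xM] := leP `|x : 'rV[R]_d|%R M; last by right; left.
  by have [xt|xt] := leP t%:E (min_dist N x a); [left|right; right].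
have pfin : p \is a fin_num by rewrite fin_num_measure.
move=> p1; have : 1 <= p + (4^-1%:E + 4^-1%:E).
  by rewrite (le_trans p1)// leeD2l// ltW// lteD.
by rewrite -(fineK pfin) -!EFinD !lee_fin; lra.
Qed.

End quantization_cost.

(** * Real powers and the rate *)

Section nth_root.
Context {R : realType} (d : nat).
Hypothesis d_gt0 : (0 < d)%N.

(** The real [d]-th root of [n]. *)
Definition droot (n : nat) : R := n%:R `^ d%:R^-1.

Lemma droot_ge1 n : (0 < n)%N -> 1 <= droot n.
Proof.
move=> n0; rewrite -(powRr0 n%:R) ler_powR ?ler1n// invr_ge0; exact: ler0n.
Qed.

Lemma drootX n : (0 < n)%N -> droot n ^+ d = n%:R.
Proof.
move=> n0; rewrite -powR_mulrn ?powR_ge0// -powRrM mulVf ?powRr1//.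
by rewrite pnatr_eq0 -lt0n.
Qed.

Lemma rateE (r : R) n : (0 < n)%N ->
  n%:R `^ (- (1 + r / d%:R)) = n%:R^-1 * (droot n `^ r)^-1.
Proof.
move=> n0; have nR : n%:R != 0 :> R by rewrite pnatr_eq0 -lt0n.
rewrite powRN powRD ?nR ?implybT// powRr1// invfM; congr (_ * _^-1).
by rewrite mulrC powRrM.
Qed.

Lemma powR_div (r x y : R) : 0 <= x -> 0 < y -> (x / y) `^ r = x `^ r / y `^ r.
Proof.
move=> x0 y0; apply: (mulIf (x := y `^ r)); first by rewrite gt_eqF ?powR_gt0.
rewrite -powRM ?divr_ge0 ?(ltW y0)// divfK ?gt_eqF// divfK//.
by rewrite gt_eqF ?powR_gt0.
Qed.

Lemma half_powR_lt1 (r : R) : 0 < r -> 2^-1 `^ r < 1.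
Proof.
move=> r0; have := gt0_ltr_powR r0 (x := 2^-1) (y := 1).
by rewrite powR1 !nnegrE; apply; rewrite ?invr_ge0// invf_lt1 ?ltr1n.
Qed.

End nth_root.

Lemma powRD_le {R : realType} (r x y : R) : 0 <= r -> 0 <= x -> 0 <= y ->
  (x + y) `^ r <= 2 `^ r * (x `^ r + y `^ r).
Proof.
move=> r0 x0 y0; wlog xy : x y x0 y0 / x <= y => [H|].
  have [/H|/ltW yx] := leP x y; first exact.
  by rewrite (addrC x) (addrC (x `^ r)) H.
rewrite (@le_trans _ _ ((2 * y) `^ r))//.
  by rewrite ge0_ler_powR ?nnegrE ?addr_ge0 ?mulr_ge0// mulrDl mul1r lerD2r.
by rewrite powRM// ler_wpM2l ?powR_ge0// lerDr powR_ge0.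
Qed.

Lemma droot_ge {R : realType} (d : nat) (B : R) : (0 < d)%N ->
  exists2 n0, (0 < n0)%N & forall n, (n0 <= n)%N -> B <= droot d n.
Proof.
move=> d0; exists (Num.truncn (`|B| ^+ d)).+1 => // n nB.
rewrite (le_trans (ler_norm B))// -(ler_pXn2r d0) ?nnegrE ?powR_ge0//.
rewrite drootX//; last exact: leq_trans nB.
by rewrite ltW// (lt_le_trans (truncnS_gt _))// ler_nat.
Qed.

(** * Lower bound for the gap *)

Section lower_bound.
Context {R : realType} {d : nat}.
Variable N : 'rV[R]_d -> R.
Hypothesis normN : is_norm N.
Variable P : probability (borelRn R d) R.
Variable r : R.
Hypothesis r_gt0 : 0 < r.
Hypothesis P_ac : P `<< lebesgue_rV R d.
Hypothesis d_gt0 : (0 < d)%N.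
Implicit Types a : {fset 'rV[R]_d}.

Lemma measurable_far_near a (y : 'rV[R]_d) (t u : R) :
  measurable ([set x | t <= rdist N a x] `&` [set x | N (x - y) <= u] :
    set (borelRn R d)).
Proof.
apply: measurableI; rewrite -[X in measurable X]setTI.
  have mf : measurable_fun [set: borelRn R d] (EFin \o rdist N a).
    by apply/measurable_EFinP; exact: measurable_rdist.
  exact: (emeasurable_fun_c_infty measurableT mf t%:E).
have mf : measurable_fun [set: borelRn R d] (EFin \o (fun x : 'rV[R]_d => N (x - y))).
  by apply/measurable_EFinP; exact: measurable_norm_sub.
exact: (emeasurable_fun_infty_c measurableT mf u%:E).
Qed.

(** Adding a point [y] to [a] improves the error on the points which are close to
    [y] but far from [a]. *)
Lemma qcost_add1 a (y : 'rV[R]_d) (t : R) : a != fset0 -> 0 < t ->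
  (qcost N P r (y |` a)%fset + (t `^ r * (1 - 2^-1 `^ r))%:E *
    P ([set x | t <= rdist N a x] `&` [set x | N (x - y) <= t / 2])%R
   <= qcost N P r a)%E.
Proof.
move=> a0 t0; set A := _ `&` _; set k := t `^ r * _.
have k0 : 0 <= k.
  by rewrite mulr_ge0 ?powR_ge0// subr_ge0 ltW// half_powR_lt1.
have mA : measurable (A : set (borelRn R d)) by exact: measurable_far_near.
have ya0 : (y |` a)%fset != fset0 by apply/fset0Pn; exists y; rewrite !inE eqxx.
have -> : (k%:E * P A = \int[P]_x (k%:E * (\1_A x)%:E))%E.
  rewrite ge0_integralZl_EFin//; first by rewrite integral_indic// setIT.
  exact/measurable_EFinP/measurable_indic.
rewrite !qcostE//.
have mk : measurable_fun [set: borelRn R d] (fun x => k%:E * (\1_A x)%:E)%E.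
  by under eq_fun do rewrite -EFinM; apply/measurable_EFinP; exact: measurable_funM.
have k1 x : (0 <= k%:E * (\1_A x)%:E)%E by rewrite -EFinM lee_fin mulr_ge0.
have rd x b : (0 <= (rdist N b x `^ r)%:E)%E by rewrite lee_fin powR_ge0.
have mrd b := measurable_rdist_powR normN r b.
rewrite -ge0_integralD//; apply: ge0_le_integral => //.
- by move=> x _; rewrite adde_ge0.
- exact: emeasurable_funD.
move=> x _; rewrite -EFinM -EFinD lee_fin indicE.
have rN b : rdist N b x \is Num.nneg by rewrite nnegrE rdist_ge0.
have [/set_mem[/= tx xy]|_] := boolP (x \in A).
  have tx2 : rdist N (y |` a)%fset x <= t * 2^-1.
    by apply: le_trans xy; apply: rdist_le; rewrite !inE eqxx.
  rewrite mulr1 (@le_trans _ _ (t `^ r))//; last first.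
    by rewrite ge0_ler_powR ?rN ?nnegrE ?(ltW t0) ?(ltW r_gt0).
  rewrite /k mulrBr mulr1 addrCA gerDl subr_le0 -powRM ?(ltW t0) ?invr_ge0//.
  by rewrite ge0_ler_powR ?rN ?(ltW r_gt0)// nnegrE mulr_ge0 ?(ltW t0).
rewrite mulr0 addr0 ge0_ler_powR ?rN ?(ltW r_gt0)//.
have [z za ->] := rdist_attained N x a0.
by apply: rdist_le; rewrite !inE za orbT.
Qed.

(** One of the points of a net with about [n] points is worth adding to a codebook
    of [n] points. *)
Lemma qinf_gap_ge : exists2 c : R, 0 < c & forall n a,
  (1 <= #|` a| <= n)%N ->
  (qinf N P r n.+1 + (c * n%:R `^ (- (1 + r / d%:R)))%:E <= qcost N P r a)%E.
Proof.
have [M [eta [M0 eta0 bulkP]]] := bulk normN P_ac d_gt0.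
have [C C0 NC] := is_norm_le_mx_norm normN.
(* n points satisfy the condition of [bulk] at distance tau / s *)
pose tau := Num.min eta 1.
have tau0 : 0 < tau by rewrite lt_min eta0 ltr01.
have taud : tau ^+ d <= eta.
  rewrite (@le_trans _ _ tau)//; last by rewrite ge_min lexx.
  by rewrite ler_iXnr ?(ltW tau0)// ge_min lexx orbT.
(* D / u bounds the mesh of the net [net_rV] with p = 1 at points of norm at most M;
   for u = u0 * s this is at most t / (2 * C) with t = tau / s *)
pose D := 2 * 1 * (1 + M) `^ (1 + 1^-1).
have D0 : 0 <= D by rewrite mulr_ge0 ?powR_ge0.
pose u0 := 1 + 2 * C * D / tau.
have u01 : 1 <= u0.
  rewrite lerDl; apply: divr_ge0 (ltW tau0).
  by apply: (mulr_ge0 _ D0); rewrite mulr_ge0 ?(ltW C0).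
pose L := (2 * u0) ^+ d.
have L0 : 0 < L by rewrite exprn_gt0// mulr_gt0// (lt_le_trans ltr01).
pose q := 1 - 2^-1 `^ r : R.
have q0 : 0 < q by rewrite subr_gt0 half_powR_lt1.
exists (tau `^ r * q / (2 * L)).
  by rewrite divr_gt0 ?mulr_gt0 ?powR_gt0.
move=> n a /andP[a1 an].
have n0 : (0 < n)%N by exact: leq_trans an.
have a0 : a != fset0 by rewrite -cardfs_gt0.
pose s : R := droot d n; have s1 : 1 <= s by exact: droot_ge1.
have s0 : 0 < s by rewrite (lt_le_trans ltr01).
pose t := tau / s; have t0 : 0 < t by rewrite divr_gt0.
have nR : 0 < n%:R :> R by rewrite ltr0n.
have /(bulkP a t t0) : #|` a|%:R * t ^+ d <= eta.
  rewrite /t expr_div_n drootX// mulrA ler_pdivrMr// mulrC.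
  by rewrite ler_pM ?exprn_ge0 ?(ltW tau0)// ler_nat.
set A := (X in P X) => PA.
have [|Y Yu YP] := @net_rV R d 1 (u0 * s) ltr01.
  by rewrite -[leLHS]mulr1 ler_pM.
have YL : #|` Y|%:R <= L * n%:R by rewrite -(drootX d_gt0 n0) -exprMn -mulrA.
pose B y := [set x | t <= rdist N a x] `&` [set x | N (x - y) <= t / 2].
have mB y : measurable (B y : set (borelRn R d)) by exact: measurable_far_near.
have AB : A `<=` \big[setU/set0]_(y <- Y) B y.
  move=> x [xM]; rewrite min_distE// lee_fin => tx; rewrite -bigcup_seq.
  have [y yY xy] := YP x; exists y => //; split => //=.
  rewrite (le_trans (NC _))// ler_pdivlMr// mulrC.
  have us0 : 0 < u0 * s by rewrite mulr_gt0// (lt_le_trans ltr01).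
  have xyD : `|x - y| <= D / (u0 * s).
    rewrite (le_trans xy)// /D [leRHS]mulrAC ler_wpM2l ?divr_ge0 ?(ltW us0)//.
    by rewrite ge0_ler_powR ?nnegrE ?addr_ge0 ?(ltW M0) ?lerD2l.
  rewrite (@le_trans _ _ (2 * (C * (D / (u0 * s)))))//.
    by rewrite !ler_pM2l.
  rewrite /t ler_pdivlMr// (_ : 2 * (C * (D / (u0 * s))) * s = 2 * C * D / u0); last first.
    by field; rewrite !gt_eqF// (lt_le_trans ltr01).
  rewrite ler_pdivrMr ?(lt_le_trans ltr01)// /u0 mulrDr mulr1.
  by rewrite [X in _ + X]mulrC divfK ?gt_eqF// lerDr ltW.
have Y0 : (Y : seq _) != [::].
  by have [y yY _] := YP 0; apply/eqP => Y0; rewrite -[_ \in _]/(y \in (Y : seq _)) Y0 in yY.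
(* the sets B y cover A, so one of them has at least the average mass *)
have [z zY] := exists_ge_average (fun y => measure_ge0 P (B y)) Y0.
move=> /(le_trans (measure_bigsetU_seq P Y mB)).
have mA : measurable (A : set (borelRn R d)) by exact: measurable_norm_min_dist.
have mUB := bigsetU_measurable _ (fun y _ => mB y).
move=> /(le_trans (le_measure P _ _ AB)); rewrite !inE => /(_ mA (mUB _ _)).
move=> /(le_trans PA) PB.
have PBfin : P (B z) \is a fin_num by rewrite fin_num_measure.
have {}PB : (2 * L * n%:R)^-1 <= fine (P (B z)).
  move: PB; rewrite /= -{1}(fineK PBfin) -EFinM lee_fin => PB.
  have L2n : 0 < 2 * L * n%:R by rewrite !mulr_gt0.
  have PB2 : 2^-1 <= L * n%:R * fine (P (B z)).
    by rewrite (le_trans PB)// ler_wpM2r// fine_ge0.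
  rewrite -[leLHS]mul1r ler_pdivrMr//; move: PB2.
  by set p := fine _; move: (L) (n%:R) (p) => x y w; lra.
apply: (le_trans _ (qcost_add1 z a0 t0)); apply: leeD.
  apply: qinf_le; rewrite cardfsU1 (leq_trans a1 (leq_addl _ _))/=.
  by rewrite -(add1n n) leq_add// leq_b1.
rewrite -/(B z) -(fineK PBfin) -EFinM lee_fin rateE//.
rewrite /t powR_div ?(ltW tau0)// -/q.
have sr0 : 0 < s `^ r by rewrite powR_gt0.
rewrite (_ : _ * _ = tau `^ r / s `^ r * q * (2 * L * n%:R)^-1).
  by rewrite ler_wpM2l// !mulr_ge0 ?powR_ge0 ?invr_ge0 ?(ltW q0) ?(ltW sr0).
by rewrite -/s; field; rewrite !gt_eqF.
Qed.

End lower_bound.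

(** * Error of the optimal order *)

Section upper_bound.
Context {R : realType} {d : nat}.
Variable N : 'rV[R]_d -> R.
Hypothesis normN : is_norm N.
Variable P : probability (borelRn R d) R.
Variable r : R.
Hypothesis r_gt0 : 0 < r.
Hypothesis d_gt0 : (0 < d)%N.
Implicit Types a : {fset 'rV[R]_d}.

Section finite_moment.
Variable delta : R.
Hypothesis delta_gt0 : 0 < delta.
Hypothesis P_moment : (\int[P]_x (N x `^ (r + delta))%:E < +oo)%E.

Let q := r + delta.
Let q_gt0 : 0 < q. Proof. by rewrite addr_gt0. Qed.

Lemma measurable_mx_norm_powR : measurable_fun [set: borelRn R d]
  (fun x : borelRn R d => ((1 + `|x : 'rV[R]_d|) `^ q)%:E).
Proof.
apply/measurable_EFinP; apply: (measurableT_comp (measurable_powR _)).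
by apply: measurable_funD => //; exact: measurable_mx_norm.
Qed.

Lemma mx_norm_moment : exists2 W : R, 0 < W &
  (\int[P]_x ((1 + `|x : 'rV[R]_d|) `^ q)%:E <= W%:E)%E.
Proof.
have [c c0 cN] := mx_norm_le_is_norm normN d_gt0.
have PI := P_moment; set I := (X in (X < _)%E) in PI.
have I0 : (0 <= I)%E by apply: integral_ge0 => x _; rewrite lee_fin powR_ge0.
have If : I \is a fin_num by rewrite ge0_fin_numE.
pose k := (c `^ q)^-1; have k0 : 0 < k by rewrite invr_gt0 powR_gt0.
have mN : measurable_fun [set: borelRn R d] (fun x : borelRn R d => (N x `^ q)%:E).
  apply/measurable_EFinP; apply: (measurableT_comp (measurable_powR _)).
  by apply: measurable_continuous_rV; exact: continuous_is_norm.
have mkN : measurable_fun [set: borelRn R d]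
    (fun x : borelRn R d => k%:E * (N x `^ q)%:E)%E.
  by apply: measurable_funeM.
have NP x : (0 <= (N x `^ q)%:E)%E by rewrite lee_fin powR_ge0.
exists (2 `^ q * (1 + k * fine I)).
  by rewrite mulr_gt0 ?powR_gt0// ltr_pwDl// mulr_ge0 ?fine_ge0// ltW.
have -> : ((2 `^ q * (1 + k * fine I))%:E =
    \int[P]_x ((2 `^ q)%:E * (1 + k%:E * (N x `^ q)%:E)))%E.
  rewrite ge0_integralZl_EFin ?powR_ge0//; last 2 first.
  - by move=> x _; rewrite adde_ge0// mule_ge0// lee_fin ltW.
  - exact: emeasurable_funD.
  rewrite ge0_integralD//; last by move=> x _; rewrite mule_ge0// lee_fin ltW.
  rewrite integral_cst// [X in (1 * X + _)%E](@probability_setT _ _ _ P) mul1e.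
  rewrite ge0_integralZl_EFin ?(ltW k0)//.
  by rewrite EFinM EFinD EFinM fineK.
apply: ge0_le_integral => //.
- exact: measurable_mx_norm_powR.
- by apply: measurable_funeM; exact: emeasurable_funD.
move=> x _; suff : (1 + `|x : 'rV[R]_d|) `^ q <= 2 `^ q * (1 + k * N x `^ q).
  by rewrite -lee_fin EFinM EFinD EFinM.
rewrite (le_trans (powRD_le _ _ _)) ?(ltW q_gt0)//.
rewrite ler_wpM2l ?powR_ge0// powR1 lerD2l /k ler_pdivlMl ?powR_gt0//.
rewrite -powRM ?(ltW c0)// ge0_ler_powR ?(ltW q_gt0) ?nnegrE//.
  by rewrite mulr_ge0 ?(ltW c0).
exact: is_norm_ge0.
Qed.

(** The classical upper bound on the quantization error: the net [net_rV], whose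
    mesh grows with the distance to the origin just slowly enough for the moment of
    order [q] to control the error, has error of order [n ^ (- r / d)]. *)
Lemma qinf_le_rate : exists2 C : R, 0 < C & forall n, (0 < n)%N -> 2 <= droot d n :> R ->
  (qinf N P r n <= (C / droot d n `^ r)%:E)%E.
Proof.
have [W W0 PW] := mx_norm_moment.
have [C C0 NC] := is_norm_le_mx_norm normN.
pose p := r / delta; have p0 : 0 < p by rewrite divr_gt0.
pose K := (4 * C * p) `^ r; have K0 : 0 < K by rewrite powR_gt0// mulr_gt0// mulr_gt0.
exists (K * W) => [|n n0 s2]; first exact: mulr_gt0.
set s := droot d n in s2 *.
have s0 : 0 < s by rewrite (lt_le_trans _ s2).
have sr0 : 0 < s `^ r by rewrite powR_gt0.
have [|Y Yn YP] := @net_rV R d p (s / 2) p0; first by rewrite ler_pdivlMr// mul1r.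
have Y0 : Y != fset0.
  by have [y yY _] := YP 0; apply/fset0Pn; exists y.
apply: (@le_trans _ _ (qcost N P r Y)).
  apply: qinf_le; rewrite cardfs_gt0 Y0/= -(ler_nat R) (le_trans Yn)//.
  by rewrite mulrC divfK// drootX.
rewrite qcostE//; apply: (@le_trans _ _
    (\int[P]_x ((K / s `^ r)%:E * ((1 + `|x : 'rV[R]_d|) `^ q)%:E))%E).
  apply: ge0_le_integral => //.
  - by move=> x _; rewrite lee_fin powR_ge0.
  - exact: measurable_rdist_powR.
  - by apply: measurable_funeM; exact: measurable_mx_norm_powR.
  move=> x _; rewrite -EFinM lee_fin.
  have [y yY xy] := YP x.
  (* the exponent of the net is such that its r-th power is the moment q *)
  have qE : q = (1 + p^-1) * r by rewrite /q /p; field; rewrite !gt_eqF.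
  have Cp0 : 0 < 4 * C * p / s by rewrite divr_gt0// mulr_gt0// mulr_gt0.
  rewrite qE [_ `^ (_ * r)]powRrM /K -powR_div//; last first.
    by rewrite mulr_ge0 ?(ltW p0)// mulr_ge0 ?(ltW C0).
  rewrite -powRM ?powR_ge0 ?(ltW Cp0)//.
  rewrite ge0_ler_powR ?(ltW r_gt0) ?nnegrE ?rdist_ge0//.
    exact: mulr_ge0 (ltW Cp0) (powR_ge0 _ _).
  rewrite (le_trans (rdist_le _ _ yY))// (le_trans (NC _))//.
  rewrite (le_trans (ler_wpM2l (ltW C0) xy))//.
  by rewrite le_eqVlt; apply/orP; left; apply/eqP; field; rewrite gt_eqF.
have Ks0 : 0 < K / s `^ r by rewrite divr_gt0.
rewrite ge0_integralZl_EFin ?(ltW Ks0)//; last exact: measurable_mx_norm_powR.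
by rewrite mulrAC (EFinM _ W) lee_wpmul2l// lee_fin ltW.
Qed.

Lemma qinf_lty n : (0 < n)%N -> (qinf N P r n < +oo)%E.
Proof.
move=> n0; have [W W0 PW] := mx_norm_moment.
have [C C0 NC] := is_norm_le_mx_norm normN.
pose z := [fset (0 : 'rV[R]_d)]%fset.
have z0 : z != fset0 by rewrite -cardfs_gt0 cardfs1.
apply: (@le_lt_trans _ _ (qcost N P r z)).
  by apply: qinf_le; rewrite cardfs1.
apply: (@le_lt_trans _ _ ((C `^ r)%:E * W%:E)%E); last by rewrite -EFinM ltry.
apply: le_trans (lee_wpmul2l _ PW); last by rewrite lee_fin powR_ge0.
rewrite -ge0_integralZl_EFin ?powR_ge0//; last exact: measurable_mx_norm_powR.
rewrite qcostE//; apply: ge0_le_integral => //.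
- by move=> x _; rewrite lee_fin powR_ge0.
- exact: measurable_rdist_powR.
- by apply: measurable_funeM; exact: measurable_mx_norm_powR.
move=> x _; rewrite -EFinM lee_fin.
have n1 : 1 <= 1 + `|x : 'rV[R]_d| by rewrite lerDl.
apply: (@le_trans _ _ (C `^ r * (1 + `|x : 'rV[R]_d|) `^ r)); last first.
  by rewrite ler_wpM2l ?powR_ge0// ler_powR// lerDl ltW.
rewrite -powRM ?(ltW C0) ?(le_trans ler01)//.
rewrite ge0_ler_powR ?(ltW r_gt0) ?nnegrE ?rdist_ge0//.
  by rewrite mulr_ge0 ?(ltW C0) ?(le_trans ler01).
have [y] := rdist_attained N x z0; rewrite inE => /eqP -> ->; rewrite subr0.
by rewrite (le_trans (NC _))// ler_pM2l// lerDr.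
Qed.

End finite_moment.
End upper_bound.

(** * Removing a point from a codebook *)

Section removal.
Context {R : realType} {d : nat}.
Variable N : 'rV[R]_d -> R.
Hypothesis normN : is_norm N.
Variable P : probability (borelRn R d) R.
Variable r : R.
Hypothesis r_gt0 : 0 < r.
Implicit Types a G Y : {fset 'rV[R]_d}.

(** If [f] sends the points of [A] to cells indexed by [Y], and points of the same
    cell are related by [e], then all the points of [A] but [#|Y|] are related to
    another point of [A]. *)
Lemma card_close (T : choiceType) (A Y : {fset T}) (e : rel T) (f : T -> T) :
  (forall y, y \in A -> f y \in Y) ->
  (forall y z, y \in A -> z \in A -> f y = f z -> e y z) ->
  (#|` A| <= #|` [fset y in A | has (fun z => (z != y) && e y z) A]%fset| + #|` Y|)%N.
Proof.
move=> fY fe; set G := (X in (_ <= #|` X| + _)%N).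
have GA : (G `<=` A)%fset by apply/fsubsetP => y; rewrite !inE => /andP[].
rewrite -(cardfsID G A) (fsetIidPr GA) leq_add2l.
have finj : {in (A `\` G)%fset &, injective f}.
  move=> y z; rewrite !inE => /andP[yG yA] /andP[_ zA] fyz.
  apply/eqP; apply: contraNT yG => yz; rewrite yA /=.
  by apply/hasP; exists z => //; rewrite eq_sym yz fe.
rewrite -(card_in_imfset imfset_key finj); apply: fsubset_leq_card.
by apply/fsubsetP => _ /imfsetP[y /= + ->]; rewrite !inE => /andP[_]; exact: fY.
Qed.

(** Removing [y] changes the distance from [x] only if [y] is the unique nearest point
    of [x] in [a], so at most one term of the sum differs from [rdist N a x `^ r]. *)
Lemma sum_rdist_remove a G (h : R) (x : 'rV[R]_d) :
  {subset G <= a} -> a != fset0 -> 0 <= h ->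
  (forall y, y \in G -> exists z, [/\ z \in a, z != y & N (y - z) <= h]) ->
  \sum_(y <- G) rdist N (a `\ y)%fset x `^ r <=
  #|` G|%:R * rdist N a x `^ r + (rdist N a x + h) `^ r.
Proof.
move=> Ga a0 h0 Gh; have [z0 z0a xz0] := rdist_attained N x a0.
have D0 := rdist_ge0 normN a x.
rewrite (@le_trans _ _ (\sum_(y <- G) (rdist N a x `^ r +
    if y == z0 then (rdist N a x + h) `^ r else 0)))//.
  rewrite big_seq [leRHS]big_seq; apply: ler_sum => y yG.
  have [yz0|yz0] := eqVneq y z0.
    rewrite ler_wpDl ?powR_ge0// ge0_ler_powR ?(ltW r_gt0) ?nnegrE ?rdist_ge0 ?addr_ge0//.
    have [z [za zy yz]] := Gh _ yG.
    rewrite (@le_trans _ _ (N (x - z)))//.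
      by apply: rdist_le; rewrite !inE zy.
    have [ND _ _] := normN.
    have -> : x - z = (x - y) + (y - z) by rewrite addrA subrK.
    by rewrite (le_trans (ND _ _))// lerD// xz0 yz0.
  rewrite addr0 ge0_ler_powR ?(ltW r_gt0) ?nnegrE ?rdist_ge0//.
  by rewrite xz0; apply: rdist_le; rewrite !inE eq_sym yz0.
rewrite big_split /= lerD//.
  rewrite big_const_seq count_predT iter_addr_0 mulr_natl.
  exact: lexx.
rewrite -big_mkcond /=; have [z0G|z0G] := boolP (z0 \in G).
  by rewrite -big_filter (@filter_pred1_uniq _ G z0)// big_seq1.
rewrite big1_seq ?powR_ge0// => y /andP[/eqP -> yG].
by rewrite yG in z0G.
Qed.

(** Some point of [G] has at most the average removal cost. *)
Lemma qcost_remove a G (h : R) :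
  {subset G <= a} -> G != fset0 -> 0 <= h ->
  (forall y, y \in G -> exists z, [/\ z \in a, z != y & N (y - z) <= h]) ->
  exists2 y, y \in G & (#|` G|%:R%:E * qcost N P r (a `\ y)%fset <=
    #|` G|%:R%:E * qcost N P r a +
    (2 `^ r)%:E * (qcost N P r a + (h `^ r)%:E))%E.
Proof.
move=> Ga G0 h0 Gh.
have a0 : a != fset0.
  by move/fset0Pn : G0 => [y /Ga ya]; apply/fset0Pn; exists y.
have Gseq : (G : seq _) != [::].
  by apply/eqP => GE; move/fset0Pn : G0 => [y]; rewrite -[_ \in _]/(y \in (G : seq _)) GE.
have [y yG] := exists_le_average (fun y => qcost_ge0 N P r (a `\ y)%fset) Gseq.
move=> yP; exists y => //; apply: (le_trans yP) => {yP y yG}.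
have mrd b := measurable_rdist_powR normN r b.
have rd b x : (0 <= (rdist N b x `^ r)%:E)%E by rewrite lee_fin powR_ge0.
have aD0 y : y \in G -> (a `\ y)%fset != fset0.
  move=> /Gh[z [za zy _]]; apply/fset0Pn; exists z; by rewrite !inE zy.
rewrite big_seq (eq_bigr (fun y => \int[P]_x (rdist N (a `\ y)%fset x `^ r)%:E)%E); last first.
  by move=> y yG; rewrite qcostE// aD0.
rewrite -big_seq -ge0_integral_sum//.
have -> : (#|` G|%:R%:E * qcost N P r a + (2 `^ r)%:E * (qcost N P r a + (h `^ r)%:E) =
    \int[P]_x (#|` G|%:R%:E * (rdist N a x `^ r)%:E +
      (2 `^ r)%:E * ((rdist N a x `^ r)%:E + (h `^ r)%:E)))%E.
  have mD : measurable_fun [set: borelRn R d]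
      (fun x : borelRn R d => (rdist N a x `^ r)%:E + (h `^ r)%:E)%E.
    exact: emeasurable_funD.
  have D0 x : (0 <= (rdist N a x `^ r)%:E + (h `^ r)%:E)%E.
    by rewrite adde_ge0// lee_fin powR_ge0.
  rewrite ge0_integralD//; last 4 first.
  - by move=> x _; rewrite mule_ge0.
  - exact: measurable_funeM.
  - by move=> x _; rewrite mule_ge0// lee_fin powR_ge0.
  - exact: measurable_funeM.
  rewrite !ge0_integralZl_EFin ?powR_ge0// ge0_integralD//; last first.
    by move=> x _; rewrite lee_fin powR_ge0.
  rewrite integral_cst// [X in ((h `^ r)%:E * X)%E](@probability_setT _ _ _ P).
  by rewrite mule1 qcostE.
apply: ge0_le_integral => //.
- by move=> x _; apply: sume_ge0 => y _.
- by apply: emeasurable_sum => y.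
- apply: emeasurable_funD; first exact: measurable_funeM.
  by apply: measurable_funeM; exact: emeasurable_funD.
move=> x _; rewrite sumEFin.
suff : \sum_(y <- G) rdist N (a `\ y)%fset x `^ r <=
    #|` G|%:R * rdist N a x `^ r + 2 `^ r * (rdist N a x `^ r + h `^ r).
  by rewrite -lee_fin EFinD EFinM EFinM EFinD.
rewrite (le_trans (sum_rdist_remove _ Ga a0 h0 Gh))// lerD2l.
by rewrite powRD_le ?(ltW r_gt0)// rdist_ge0.
Qed.

End removal.

(** * Upper bound for the gap *)

Section upper_gap.
Context {R : realType} {d : nat}.
Variable N : 'rV[R]_d -> R.
Hypothesis normN : is_norm N.
Variable P : probability (borelRn R d) R.
Variable r : R.
Hypothesis r_gt0 : 0 < r.
Hypothesis P_ac : P `<< lebesgue_rV R d.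
Hypothesis d_gt0 : (0 < d)%N.
Variable delta : R.
Hypothesis delta_gt0 : 0 < delta.
Hypothesis P_moment : (\int[P]_x (N x `^ (r + delta))%:E < +oo)%E.
Implicit Types a : {fset 'rV[R]_d}.

(** A codebook whose error has the optimal order has at least [k * n] points in a fixed
    ball: otherwise half of the mass would be at distance at least [tau / s] from it,
    with [tau] so large that the error would exceed [C / s ^ r]. *)
Lemma card_bulk (C : R) : 0 < C -> exists M k B : R, [/\ 0 < M, 0 < k &
  forall n a, (0 < n)%N -> B <= droot d n -> a != fset0 ->
    (qcost N P r a <= (C / droot d n `^ r)%:E)%E ->
    k * n%:R <= #|` [fset y in a | `|y| <= M]%fset|%:R].
Proof.
move=> C0; have [M [eta [M0 eta0 bulkP]]] := bulk normN P_ac d_gt0.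
have [c c0 cN] := mx_norm_le_is_norm normN d_gt0.
(* tau ^ r / 2 exceeds C *)
pose tau := (2 * C + 1) `^ r^-1.
have tau0 : 0 < tau by rewrite powR_gt0// ltr_pwDr// mulr_ge0 ?(ltW C0).
have tauX : tau `^ r = 2 * C + 1.
  by rewrite -powRrM mulVf ?gt_eqF// powRr1// addr_ge0// mulr_ge0 ?(ltW C0).
have taud0 : 0 < tau ^+ d by rewrite exprn_gt0.
exists (M + 1), (eta / tau ^+ d), (1 + tau / c); split.
- by rewrite addr_gt0.
- by rewrite divr_gt0.
move=> n a n0 sB a0 aC.
set s := droot d n in sB aC *; set b := [fset y in a | _]%fset.
have s0 : 0 < s by rewrite (lt_le_trans _ sB)// addr_gt0// divr_gt0.
rewrite leNgt; apply/negP => bn.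
pose t := tau / s; have t0 : 0 < t by rewrite divr_gt0.
have tc : t <= c.
  rewrite ler_pdivrMr// mulrC -ler_pdivrMr// (le_trans _ sB)//.
  by rewrite lerDr.
have /(bulkP b t t0) : #|` b|%:R * t ^+ d <= eta.
  rewrite /t expr_div_n drootX// mulrA ler_pdivrMr ?ltr0n//.
  by rewrite -ler_pdivlMr// mulrAC ltW.
set A := (X in P X) => PA.
have mA : measurable (A : set (borelRn R d)) by exact: measurable_norm_min_dist.
have At x : A x -> t <= rdist N a x.
  move=> [xM tb]; have [y ya ->] := rdist_attained N x a0.
  have [yM|yM] := leP `|y| (M + 1).
    by rewrite -lee_fin (le_trans tb)// min_dist_le// !inE ya.
  (* points outside the ball of radius M + 1 are at distance at least c >= t from x *)
  rewrite (le_trans tc)// (le_trans _ (cN _))// ler_peMr ?(ltW c0)//.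
  have := lerB_dist y x; rewrite distrC; apply: le_trans.
  by rewrite lerBrDl (le_trans _ (ltW yM))// lerD2r.
have tr0 : 0 <= t `^ r by exact: powR_ge0.
suff : ((t `^ r)%:E * P A <= qcost N P r a)%E.
  apply/negP; rewrite -ltNge (le_lt_trans aC)//.
  apply: (@lt_le_trans _ _ ((t `^ r)%:E * 2^-1%:E)%E); last first.
    by rewrite lee_wpmul2l ?lee_fin.
  rewrite -EFinM lte_fin /t powR_div ?(ltW tau0)// tauX mulrAC.
  have sr0 : 0 < s `^ r by exact: powR_gt0.
  by rewrite ltr_pM2r ?invr_gt0//; lra.
have -> : ((t `^ r)%:E * P A = \int[P]_x ((t `^ r)%:E * (\1_A x)%:E))%E.
  rewrite ge0_integralZl_EFin//; first by rewrite integral_indic// setIT.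
  exact/measurable_EFinP/measurable_indic.
rewrite qcostE//.
apply: ge0_le_integral => //.
- by move=> x _; rewrite -EFinM lee_fin mulr_ge0.
- by under eq_fun do rewrite -EFinM; apply/measurable_EFinP; exact: measurable_funM.
- exact: measurable_rdist_powR.
move=> x _; rewrite -EFinM lee_fin indicE.
have [/set_mem/At xt|_] := boolP (x \in A); last by rewrite mulr0 powR_ge0.
by rewrite mulr1 ge0_ler_powR ?(ltW r_gt0) ?nnegrE ?(ltW t0) ?rdist_ge0.
Qed.

(** A codebook of [n + 1] points with an error of the optimal order has a point whose
    removal is cheap; in the other cases the bound is immediate. *)
Lemma qinf_gap_le : exists C n0, 0 < C /\ forall n a, (n0 <= n)%N ->
  (1 <= #|` a| <= n.+1)%N ->
  (qinf N P r n <= qcost N P r a + (C * n%:R `^ (- (1 + r / d%:R)))%:E)%E.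
Proof.
have [C1 C10 zador] := qinf_le_rate normN r_gt0 d_gt0 delta_gt0 P_moment.
have [M [k [B [M0 k0 bulkP]]]] := card_bulk C10.
have [C C0 NC] := is_norm_le_mx_norm normN.
(* the net below has at most k n / 2 points *)
pose rho := (k / 2) `^ d%:R^-1.
have rho0 : 0 < rho by rewrite powR_gt0// divr_gt0.
have rhoX : rho ^+ d = k / 2.
  rewrite -powR_mulrn ?powR_ge0// -powRrM mulVf ?powRr1 ?pnatr_eq0 -?lt0n//.
  by rewrite divr_ge0 ?(ltW k0).
pose D := 2 * 1 * (1 + M) `^ (1 + 1^-1).
have D0 : 0 < D by rewrite mulr_gt0// powR_gt0// addr_gt0.
(* H / s bounds the distance in N between two points of the same cell *)
pose H := C * (4 * D / rho).
have H0 : 0 < H by rewrite mulr_gt0// divr_gt0// mulr_gt0.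
pose K := 2 `^ r * (C1 + H `^ r).
have K0 : 0 < K by rewrite mulr_gt0 ?powR_gt0// addr_gt0// powR_gt0.
have [n0 n00 n0P] := droot_ge (2 + 2 / rho + `|B|) d_gt0.
exists (2 * K / k), n0; split; first by rewrite divr_gt0// mulr_gt0.
move=> n a /[dup] n0n /n0P; set s := droot d n => sB /andP[a1 an].
have n1 : (0 < n)%N by exact: leq_trans n0n.
have s2 : 2 <= s.
  by rewrite (le_trans _ sB)// -addrA lerDl addr_ge0// divr_ge0 ?(ltW rho0).
have s0 : 0 < s by rewrite (lt_le_trans _ s2).
have sr0 : 0 < s `^ r by rewrite powR_gt0.
have srho : 2 / rho <= s.
  by rewrite (le_trans _ sB)// addrAC lerDr addr_ge0.
have Bs : B <= s.
  rewrite (le_trans (ler_norm B))// (le_trans _ sB)// lerDr addr_ge0//.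
  by rewrite divr_ge0 ?(ltW rho0).
have nR : 0 < n%:R :> R by rewrite ltr0n.
have rate0 : 0 <= 2 * K / k * n%:R `^ (- (1 + r / d%:R)).
  by rewrite mulr_ge0 ?powR_ge0// divr_ge0 ?(ltW k0)// mulr_ge0 ?(ltW K0).
have [aC|aC] := leP (qcost N P r a) (C1 / s `^ r)%:E; last first.
  rewrite (le_trans (zador n n1 s2))// (le_trans (ltW aC))//.
  by rewrite leeDl.
have [an'|an'] := leqP #|` a| n.
  apply: (@le_trans _ _ (qcost N P r a)); first by apply: qinf_le; rewrite a1.
  by rewrite leeDl.
have a0 : a != fset0 by rewrite -cardfs_gt0.
have {}bulkP := bulkP n a n1 Bs a0 aC.
set b := [fset y in a | _]%fset in bulkP.
have [|Y Yn YP] := @net_rV R d 1 (rho * s / 2) ltr01.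
  by rewrite ler_pdivlMr// mul1r mulrC -ler_pdivrMr.
have {}Yn : #|` Y|%:R <= k / 2 * n%:R.
  by rewrite (le_trans Yn)// mulrC divfK// exprMn rhoX drootX.
have /choice[f fP] : forall x : 'rV[R]_d, exists y, y \in Y /\
    `|x - y| <= 2 * 1 / (rho * s / 2) * (1 + `|x|) `^ (1 + 1^-1).
  by move=> x; have [y yY xy] := YP x; exists y.
pose h := H / s; have h0 : 0 <= h by rewrite divr_ge0 ?(ltW H0) ?(ltW s0).
pose near : rel 'rV[R]_d := fun y z => N (y - z) <= h.
have bM y : y \in b -> `|y - f y| <= 2 * D / (rho * s).
  rewrite !inE /= => /andP[_ yM]; have [_ yf] := fP y; rewrite (le_trans yf)//.
  rewrite (_ : 2 * D / (rho * s) =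
    2 * 1 / (rho * s / 2) * (1 + M) `^ (1 + 1^-1)); last first.
    by rewrite /D; field; rewrite !gt_eqF.
  rewrite ler_wpM2l ?divr_ge0 ?mulr_ge0 ?(ltW rho0) ?(ltW s0)//.
  by rewrite ge0_ler_powR ?nnegrE ?addr_ge0 ?(ltW M0) ?lerD2l.
have := @card_close _ b Y near f; set G := (X in (_ <= #|` X| + _)%N) => cardG.
have {}cardG : (#|` b| <= #|` G| + #|` Y|)%N.
  apply: cardG => [y _|y z yb zb yz]; first by have [] := fP y.
  rewrite /near (le_trans (NC _))// (_ : y - z = (y - f y) - (z - f z)); last first.
    by rewrite yz opprB addrA subrK.
  rewrite (_ : h = C * (2 * D / (rho * s) + 2 * D / (rho * s))); last first.
    by rewrite /h /H; field; rewrite !gt_eqF.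
  by rewrite ler_pM2l// (le_trans (ler_normB _ _))// lerD ?bM.
have {cardG bulkP Yn} Gn : k / 2 * n%:R <= #|` G|%:R.
  move: cardG; rewrite -(ler_nat R) natrD; lra.
have Gn0 : 0 < #|` G|%:R :> R by rewrite (lt_le_trans _ Gn)// mulr_gt0// divr_gt0.
have Ga : {subset G <= a} by move=> y; rewrite !inE => /andP[/andP[]].
have [||y yG yP] := @qcost_remove _ _ N normN P r r_gt0 a G h Ga _ h0.
- by rewrite -cardfs_gt0 -(ltr_nat R).
- move=> y; rewrite !inE => /andP[_ /hasP[z zb /andP[zy yz]]]; exists z; split => //.
  by move: zb; rewrite !inE => /andP[].
have ay : (1 <= #|` (a `\ y)%fset| <= n)%N.
  have := cardfsD1 y a; rewrite (Ga _ yG) => aE.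
  by move: an an'; rewrite aE !add1n !ltnS => -> n_lt; rewrite (leq_trans n1).
rewrite (le_trans (qinf_le N P r ay))//.
have qf : qcost N P r a \is a fin_num.
  by rewrite ge0_fin_numE ?qcost_ge0// (le_lt_trans aC)// ltry.
rewrite -(@lee_pmul2l _ #|` G|%:R%:E)//.
have qC : fine (qcost N P r a) <= C1 / s `^ r by rewrite -lee_fin fineK.
apply: (le_trans yP); rewrite -(fineK qf).
move: (fine _) qC => z qC; set v := 2 * K / k * _.
suff : #|` G|%:R * z + 2 `^ r * (z + h `^ r) <= #|` G|%:R * (z + v).
  by rewrite -lee_fin EFinD !EFinM !EFinD.
rewrite /v [leRHS]mulrDr lerD2l (@le_trans _ _ (K / s `^ r))//.
  rewrite /K -mulrA ler_wpM2l ?powR_ge0// mulrDl lerD//.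
  by rewrite /h powR_div ?(ltW H0).
rewrite rateE// -/s (_ : K / s `^ r =
  k / 2 * n%:R * (2 * K / k * (n%:R^-1 / s `^ r))); last first.
  by field; rewrite !gt_eqF.
have Kk0 : 0 < 2 * K / k by rewrite divr_gt0// mulr_gt0.
have ns0 : 0 < n%:R^-1 / s `^ r by rewrite divr_gt0 ?invr_gt0.
by apply: ler_wpM2r; rewrite // ltW// mulr_gt0.
Qed.
End upper_gap.

Theorem proposition2p3 (R : realType) (d : nat) (d_ge1 : (1 <= d)%N)
    (N : 'rV[R]_d -> R) (normN : is_norm N)
    (r : R) (r_gt0 : 0 < r)
    (P : probability (borelRn R d) R)
    (P_ac : P `<< lebesgue_rV R d)
    (P_moment : exists2 delta : R, 0 < delta &
      (\int[P]_x (N x `^ (r + delta))%:E < +oo)%E) :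
  same_order
    (fun n => quantization_error N P r n `^ r
            - quantization_error N P r n.+1 `^ r)%E
    (fun n => n%:R `^ (- (1 + r / d%:R))).
Proof.
have [delta delta0 Pdelta] := P_moment.
have [c c0 lower] := qinf_gap_ge normN r_gt0 P_ac d_ge1.
have [C [n0 [C0 upper]]] := qinf_gap_le normN r_gt0 P_ac d_ge1 delta0 Pdelta.
pose E n := fine (qinf N P r n).
have EE n : (0 < n)%N -> qinf N P r n = (E n)%:E.
  move=> n_gt0; rewrite fineK// ge0_fin_numE ?qinf_ge0//.
  exact: (qinf_lty normN r_gt0 d_ge1 delta0 Pdelta).
pose rate n : R := n%:R `^ (- (1 + r / d%:R)).
have rate0 n : (0 < n)%N -> 0 < rate n by move=> n_gt0; rewrite powR_gt0// ltr0n.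
have lo n : (0 < n)%N -> E n.+1 + c * rate n <= E n.
  move=> n_gt0; rewrite -lee_fin EFinD -!EE//; apply: le_ereal_inf_tmp => _ [a an <-].
  exact: lower.
have up n : (0 < n)%N -> (n0 <= n)%N -> E n <= E n.+1 + C * rate n.
  move=> n_gt0 n0n; rewrite -lerBlDr -lee_fin EFinB -!EE//.
  apply: le_ereal_inf_tmp => _ [a an <-].
  by rewrite leeBlDr// upper.
have E_ge0 n : 0 <= E n by rewrite fine_ge0// qinf_ge0.
exists c, (C + E 1 / rate n0.+1); split => // n n1.
rewrite !quantization_errorX// !EE// -EFinB -EFinM abse_EFin !lee_fin -/(rate n).
have rn := rate0 _ n1.
have gap : c * rate n <= E n - E n.+1 by rewrite lerBrDl lo.
have gap0 : 0 <= E n - E n.+1 by rewrite (le_trans _ gap)// mulr_ge0 ?ltW.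
rewrite ger0_norm ?mulr_ge0 ?invr_ge0 ?(ltW rn)//; apply/andP; split.
  by rewrite ler_pdivlMr.
(* below n0 the gap is at most E 1 and the rate at least the one at n0 + 1 *)
have [n0n|nn0] := leqP n0 n.
  rewrite (@le_trans _ _ C)//; last by rewrite lerDl divr_ge0// ltW// rate0.
  by rewrite ler_pdivrMr// lerBlDl up.
rewrite (@le_trans _ _ (E 1 / rate n0.+1))//; last by rewrite lerDr ltW.
apply: ler_pM => //; first by rewrite invr_ge0 ltW.
  rewrite (@le_trans _ _ (E n)) ?gerBl//.
  by rewrite -lee_fin -!EE// le_qinf.
rewrite lef_pV2 ?posrE ?rate0// /rate !powRN lef_pV2 ?posrE ?powR_gt0 ?ltr0n//.
rewrite ge0_ler_powR ?nnegrE ?ler_nat ?(ltW nn0) ?(leqW (ltnW nn0))//.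
by rewrite addr_ge0// divr_ge0// ltW.
Qed.
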